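(* Let $\mathfrak g$ be a real Lie algebra of real dimension $2n$, $n\ge 3$, endowed with a complex structure $J$, and let $1\le p<n-1$. Suppose that $(\mathfrak g,J)$ admits a $p$-Kähler structure $\Omega$ and that there exists a non-zero $d$-closed $(1,0)$-form $\alpha$ on $(\mathfrak g,J)$. Then $\mathfrak g$ has a $J$-invariant ideal $\mathfrak h$ of real codimension $2$ such that $(\mathfrak h,J|_{\mathfrak h})$ admits a $p$-Kähler structure.
   Context: A complex structure on a real Lie algebra $\mathfrak g$ is an endomorphism $J$ with $J^2=-\mathrm{Id}$ that is integrable (vanishing Nijenhuis tensor). The $(1,0)$-forms are the elements of the $i$-eigenspace $\mathfrak g^{1,0}$ of $J$ acting on the complexified dual of $\mathfrak g$ (i.e. $\alpha(JX)=i\,\alpha(X)$), and $d$ is the Chevalley–Eilenberg differential. Positivity. Let $V$ be a complex vector space of dimension $n$ and $\Lambda^{p,q}$ the space of $(p,q)$-forms on $V$. An $(n,n)$-form $\nu$ is positive if $\nu=c\,i\alpha^1\wedge\overline{\alpha^1}\wedge\cdots\wedge i\alpha^n\wedge\overline{\alpha^n}$ with $c\in\mathbb R_{\ge0}$ and $\{\alpha^j\}$ a basis of $\Lambda^{1,0}$; it is a volume form if $c>0$. A $(q,0)$-form is simple if it is of the form $\mu_1\wedge\dots\wedge\mu_q$ with $\mu_j\in\Lambda^{1,0}$. A $(k,k)$-form $\Omega$ is transverse if for every non-zero simple $(n-k,0)$-form $\psi$ the $(n,n)$-form $i^{(n-k)^2}\,\Omega\wedge\psi\wedge\bar\psi$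 is a volume form. A $p$-Kähler structure on a Lie algebra with complex structure $(\mathfrak g,J)$ of complex dimension $n$ ($1\le p<n$) is a real transverse $(p,p)$-form $\Omega$ on $(\mathfrak g,J)$ (a complex vector space via $J$) with $d\Omega=0$. *)

(* Defs.v *)
From mathcomp Require Import all_boot all_order all_algebra.
From mathcomp Require Import reals.
From mathcomp.real_closed Require Export complex.

Set Implicit Arguments.
Unset Strict Implicit.
Unset Printing Implicit Defensive.

Import GRing.Theory Num.Theory.
Local Open Scope ring_scope.
Local Open Scope complex_scope.

Section Forms.
Variables (R : realType) (V : vectType R).

(* A complex-valued form on the real vector space V is given by its values on
   finite sequences of vectors; its component of degree k is the restriction
   to the sequences of size k. *)
Definition cform := seq V -> R[i].

Definition kform (k : nat) (w : cform) : Prop :=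
  [/\ forall v, size v != k -> w v = 0,
      forall (s t : seq V) (a : R) (x y : V),
        w (s ++ (a *: x + y) :: t) = a%:C * w (s ++ x :: t) + w (s ++ y :: t)
    & forall (s t u : seq V) (x : V), w (s ++ x :: t ++ x :: u) = 0].

Definition nonzero_form (w : cform) : Prop := exists v, w v != 0.

Definition conj_form (w : cform) : cform := fun v => (w v)^*.

Definition real_form (w : cform) : Prop := conj_form w =1 w.

Definition scale_form (c : R[i]) (w : cform) : cform := fun v => c * w v.

Definition shuffle_inv (k : nat) (m : k.-tuple bool) : nat :=
  #|[set ij : 'I_k * 'I_k |
      [&& (ij.1 < ij.2)%N, ~~ tnth m ij.1 & tnth m ij.2]]|.

(* Sum over the shuffles of v: the mask m selects the vectors given to a, the
   other ones are given to b. On forms of degrees k and l this is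
   1/(k! l!) times the signed sum over all permutations. *)
Definition wedge (a b : cform) : cform := fun v =>
  \sum_(m : (size v).-tuple bool)
    (-1) ^+ shuffle_inv m * a (mask m v) * b (mask (map negb m) v).

Definition unit_form : cform := fun v => (size v == 0)%:R.

Section ComplexVectorSpace.
(* J is the multiplication by i on the complex vector space V. *)
Variable J : 'End(V).

Definition form10 (a : cform) : Prop :=
  kform 1 a /\ forall x, a [:: J x] = 'i%C * a [:: x].

Definition cdim : nat := (\dim {:V})./2.

Definition basis10 (a : 'I_cdim -> cform) : Prop :=
  [/\ forall j, form10 (a j),
      forall c : 'I_cdim -> R[i],
        (forall v, \sum_j c j * a j v = 0) -> forall j, c j = 0
    & forall b, form10 b ->
        exists c : 'I_cdim -> R[i], forall v, b v = \sum_j c j * a j v].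

Definition simple_form (q : nat) (w : cform) : Prop :=
  exists2 mu : 'I_q -> cform,
    (forall j, form10 (mu j)) & w =1 \big[wedge/unit_form]_(j < q) mu j.

(* The span of the wedge products of p forms of type (1,0) and q conjugates of
   such forms. *)
Definition pqform (p q : nat) (w : cform) : Prop :=
  exists (N : nat) (c : 'I_N -> R[i])
         (a : 'I_N -> 'I_p -> cform) (b : 'I_N -> 'I_q -> cform),
  [/\ forall t j, form10 (a t j),
      forall t j, form10 (b t j)
    & forall v, w v = \sum_(t < N) c t *
        wedge (\big[wedge/unit_form]_(j < p) a t j)
              (\big[wedge/unit_form]_(j < q) conj_form (b t j)) v].

Definition volume_form (w : cform) : Prop :=
  exists (c : R) (a : 'I_cdim -> cform),
  [/\ 0 < c, basis10 a
    & w =1 scale_form c%:C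
        (\big[wedge/unit_form]_(j < cdim)
           scale_form 'i%C (wedge (a j) (conj_form (a j))))].

Definition transverse (k : nat) (w : cform) : Prop :=
  forall psi, simple_form (cdim - k) psi -> nonzero_form psi ->
    volume_form (scale_form ('i%C ^+ ((cdim - k) ^ 2))
                   (wedge (wedge w psi) (conj_form psi))).

End ComplexVectorSpace.

Section LieAlgebra.
Variable br : V -> V -> V.

Definition lie_bracket : Prop :=
  [/\ forall (a : R) x y z, br (a *: x + y) z = a *: br x z + br y z,
      forall (a : R) x y z, br z (a *: x + y) = a *: br z x + br z y,
      forall x, br x x = 0
    & forall x y z, br x (br y z) + br y (br z x) + br z (br x y) = 0].

Definition complex_structure (J : 'End(V)) : Prop :=
  (forall x, J (J x) = - x) /\
  (forall x y, br (J x) (J y) - J (br (J x) y) - J (br x (J y)) - br x y = 0).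

Definition lie_ideal (h : {vspace V}) : Prop :=
  forall x y, y \in h -> br x y \in h.

Definition omit (i : nat) (v : seq V) : seq V := take i v ++ drop i.+1 v.

Definition chevalley_eilenberg_d (w : cform) : cform := fun v =>
  \sum_(i < size v) \sum_(j < size v | (i < j)%N)
    (-1) ^+ (i + j) * w (br v`_i v`_j :: omit i (omit j v)).

Definition closed_form (w : cform) : Prop :=
  forall v, chevalley_eilenberg_d w v = 0.

Definition pkahler (J : 'End(V)) (p : nat) (w : cform) : Prop :=
  (1 <= p < cdim)%N /\
  [/\ pqform J p p w, real_form w, transverse J p w & closed_form w].

End LieAlgebra.

End Forms.

Section Restriction.
Variables (R : realType) (V : vectType R).

Definition restr_br (br : V -> V -> V) (h : {vspace V}) :
    subvs_of h -> subvs_of h -> subvs_of h :=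
  fun x y => vsproj h (br (vsval x) (vsval y)).
Arguments restr_br br h : clear implicits.

Definition restr_end (J : 'End(V)) (h : {vspace V}) : 'End(subvs_of h) :=
  linfun (fun x : subvs_of h => vsproj h (J (vsval x))).

Lemma restr_endE (J : 'End(V)) (h : {vspace V}) (x : subvs_of h) :
  (J @: h <= h)%VS -> vsval (restr_end J h x) = J (vsval x).
Proof.
move=> Jh; rewrite /restr_end.
have -> : linfun (fun x : subvs_of h => vsproj h (J (vsval x))) =
  linfun (vsproj h \o (J \o vsval)) by [].
rewrite lfunE /= vsprojK //.
by apply: (subvP Jh); apply: memv_img; apply: subvsP.
Qed.

Lemma restr_brE br (h : {vspace V}) (x y : subvs_of h) :
  lie_ideal br h -> vsval (restr_br br h x y) = br (vsval x) (vsval y).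
Proof. by move=> hh; rewrite vsprojK //; apply/hh/subvsP. Qed.

Lemma restr_lie_bracket br (h : {vspace V}) :
  lie_bracket br -> lie_ideal br h -> lie_bracket (restr_br br h).
Proof.
move=> [Dl Dr alt jac] hh; split=> *; apply: val_inj.
- by rewrite /= restr_brE // !linearP /= !restr_brE // Dl.
- by rewrite /= restr_brE // !linearP /= !restr_brE // Dr.
- by rewrite /= restr_brE // alt linear0.
- by rewrite [LHS]linearD [in LHS]linearD /= !restr_brE // jac linear0.
Qed.

Lemma restr_complex_structure br (J : 'End(V)) (h : {vspace V}) :
  complex_structure br J -> lie_ideal br h -> (J @: h <= h)%VS ->
  complex_structure (restr_br br h) (restr_end J h).
Proof.
move=> [JJ N] hh Jh; split=> *; apply: val_inj.
- by rewrite /= !restr_endE // JJ linearN.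
- by rewrite /= !(linearB, restr_endE, restr_brE) // N linear0.
Qed.

End Restriction.

Arguments restr_br {R V} br h.

(* Main.v *)
From HB Require Import structures.
Require Import Defs.
From mathcomp Require Import all_boot all_order all_algebra.
From mathcomp Require Import boolp reals ring zify.
Set Implicit Arguments. Unset Strict Implicit. Unset Printing Implicit Defensive.
Import Order.TTheory GRing.Theory Num.Theory.
Local Open Scope ring_scope.
Local Open Scope complex_scope.

(** A closed form alpha of degree 1 vanishes on all brackets, because
    d alpha (x, y) = - alpha ([x, y]).  So the kernel h of alpha is an ideal;
    as alpha is of type (1,0) and non-zero, h is J-invariant of real codimension
    2.  The p-Kaehler structure on h is the restriction of Omega.  Restriction
    commutes with wedge products, conjugation and d, and it preserves the type
    (1,0), so the only point that needs an argument is transversality.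

    Let q = dim_C h - p, let psi = mu_1 ^ ... ^ mu_q be a non-zero simple form on
    h, extend the mu_j to (1,0)-forms on g, with product M, and test Omega on the
    simple (q+1,0)-form alpha ^ M.  It is non-zero, and reordering the factors
    turns the resulting volume form into
      i alpha ^ conj alpha ^ W,  where W = i^(q^2) Omega ^ M ^ conj M
    ([transverse_sign] collects the signs).  On the other hand it equals
    c times the product of the i a_j ^ conj a_j, for some c > 0 and some coframe
    a_j.  Write alpha = sum_j d_j a_j with d_k <> 0, and let P be the product over
    j <> k.  Every a_j with j <> k is killed by P, so
      i alpha ^ conj alpha ^ P = |d_k|^2 times the product over all j
    ([herm_exchange]).  Hence i alpha ^ conj alpha ^ W and
    (c / |d_k|^2) i alpha ^ conj alpha ^ P agree.  Contracting with e and J e,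
    where alpha e = 1, and restricting to h removes the first two factors
    ([herm_contract]): W = (c / |d_k|^2) P on h.  Finally the a_j with j <> k
    restrict to a coframe of h ([coframe_res]), so W is a volume form on h.

    The wedge product is a sum over shuffles.  Splitting it according to the
    factor that receives the first vector gives the recursion [wedge_cons], i.e.
    the fact that a contraction is a graded derivation.  Associativity and graded
    commutativity follow from it by induction on the list of vectors. *)

Local Notation "\wedge_ ( i < n ) F" :=
  (\big[@wedge _ _/@unit_form _ _]_(i < n) F)
  (at level 36, F at level 36, i, n at level 50,
   format "'[' \wedge_ ( i  <  n ) '/  '  F ']'").

(** * The algebra of forms *)

Section FormAlgebra.
Variables (R : realType) (V : vectType R).
Implicit Types (a b c : cform V) (x : V) (s v : seq V).

Definition contract x a : cform V := fun s => a (x :: s).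
(** The grading involution, as an operation on forms of mixed degree. *)
Definition parity a : cform V := fun s => (-1) ^+ size s * a s.
Definition add_form a b : cform V := fun s => a s + b s.

Lemma shuffle_invE k (m : k.-tuple bool) :
  shuffle_inv m =
  (\sum_(i < k) \sum_(j < k) [&& i < j, ~~ tnth m i & tnth m j])%N.
Proof.
rewrite /shuffle_inv -sum1dep_card pair_big /= big_mkcond /=.
by apply: eq_bigr => -[i j] _ /=; case: ifP.
Qed.

Lemma shuffle_inv_cons k y (m : k.-tuple bool) :
  shuffle_inv [tuple of y :: m] = ((if y then 0 else count id m) + shuffle_inv m)%N.
Proof.
rewrite !shuffle_invE big_ord_recl; congr (_ + _)%N.
  rewrite big_ord_recl /= add0n; under eq_bigr => j _ do rewrite tnthS.
  case: y; first by rewrite big1.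
  rewrite -sum1_count [RHS]big_mkcond big_tuple.
  by apply: eq_bigr => j _; case: (tnth m j).
apply: eq_bigr => i _; rewrite big_ord_recl /= add0n.
by apply: eq_bigr => j _; rewrite !tnthS.
Qed.

Lemma wedge_nil a b : wedge a b [::] = a [::] * b [::].
Proof.
rewrite /wedge /= (big_pred1 [tuple]) /=; last first.
  by move=> m; apply/esym/eqP; apply: val_inj; rewrite /= (tuple0 m).
suff -> : shuffle_inv [tuple of [::]] = 0%N by rewrite mul1r.
by rewrite shuffle_invE big_ord0.
Qed.

(** The two summands are the shuffles that give [x] to [a] and to [b].  In the
    second case [x] makes an inversion with every vector given to [a]: their
    number is the size of the argument of [a], whence [parity]. *)
Lemma wedge_cons a b x v :
  wedge a b (x :: v) = wedge (contract x a) b v + wedge (parity a) (contract x b) v.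
Proof.
rewrite /wedge /=.
rewrite (reindex (fun q : bool * (size v).-tuple bool => [tuple of q.1 :: q.2])) /=;
  last first.
  exists (fun m : (size v).+1.-tuple bool => (thead m, [tuple of behead m])).
    by move=> [y m] _ /=; congr pair; apply: val_inj.
  by move=> m _; rewrite /= -tuple_eta.
transitivity (\sum_(y : bool) \sum_(m : (size v).-tuple bool)
   (-1) ^+ shuffle_inv [tuple of y :: m] *
   a (mask (y :: m) (x :: v)) * b (mask (~~ y :: map negb m) (x :: v))).
  by rewrite pair_big.
rewrite big_bool /=; congr (_ + _); apply: eq_bigr => m _; rewrite shuffle_inv_cons //=.
by rewrite /parity size_mask ?size_tuple // exprD -!mulrA mulrCA.
Qed.

Lemma contract_wedge x a b :
  contract x (wedge a b) =
  add_form (wedge (contract x a) b) (wedge (parity a) (contract x b)).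
Proof. by apply: funext => v; apply: wedge_cons. Qed.

Lemma contract_parity x a :
  contract x (parity a) = scale_form (-1) (parity (contract x a)).
Proof. by apply: funext => v; rewrite /contract /parity /scale_form /= exprS mulrA. Qed.

Lemma wedgeDl a b c :
  wedge (add_form a b) c = add_form (wedge a c) (wedge b c).
Proof.
apply: funext => v; rewrite /wedge /add_form -big_split.
by apply: eq_bigr => m _; rewrite mulrDr mulrDl.
Qed.

Lemma wedgeDr a b c :
  wedge a (add_form b c) = add_form (wedge a b) (wedge a c).
Proof.
apply: funext => v; rewrite /wedge /add_form -big_split.
by apply: eq_bigr => m _; rewrite mulrDr.
Qed.

Lemma wedgeZl z a b : wedge (scale_form z a) b = scale_form z (wedge a b).
Proof.
apply: funext => v; rewrite /wedge /scale_form mulr_sumr.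
by apply: eq_bigr => m _; rewrite !mulrA [_ * z]mulrC.
Qed.

Lemma wedgeZr z a b : wedge a (scale_form z b) = scale_form z (wedge a b).
Proof.
apply: funext => v; rewrite /wedge /scale_form mulr_sumr.
by apply: eq_bigr => m _; rewrite mulrCA.
Qed.

Lemma wedge_suml n (F : 'I_n -> cform V) b v :
  wedge (fun s => \sum_i F i s) b v = \sum_i wedge (F i) b v.
Proof.
rewrite /wedge exchange_big; apply: eq_bigr => m _.
by rewrite mulr_sumr mulr_suml.
Qed.

Lemma scale_formA y z a : scale_form y (scale_form z a) = scale_form (y * z) a.
Proof. by apply: funext => v; rewrite /scale_form mulrA. Qed.

Lemma scale_form1 a : scale_form 1 a = a.
Proof. by apply: funext => v; rewrite /scale_form mul1r. Qed.

Lemma scale_form_eq0 z : scale_form z (fun=> 0) = (fun=> 0) :> cform V.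
Proof. by apply: funext => v; rewrite /scale_form mulr0. Qed.

Lemma wedge0l b : wedge (fun=> 0) b = (fun=> 0).
Proof. by apply: funext => v; rewrite /wedge big1 // => m _; rewrite mulr0 mul0r. Qed.

Lemma wedge0r a : wedge a (fun=> 0) = (fun=> 0).
Proof. by apply: funext => v; rewrite /wedge big1 // => m _; rewrite mulr0. Qed.

Lemma parity_wedge a b : parity (wedge a b) = wedge (parity a) (parity b).
Proof.
apply: funext => v; elim: v a b => [|x v IH] a b.
  by rewrite wedge_nil /parity /= !mul1r wedge_nil.
rewrite wedge_cons !contract_parity wedgeZl wedgeZr /scale_form -!IH.
by rewrite /parity /= wedge_cons exprS -mulrA !mulrDr.
Qed.

(** Both sides satisfy the same recursion, as contractions are derivations and
    [parity] is multiplicative. *)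
Lemma wedgeA a b c : wedge a (wedge b c) = wedge (wedge a b) c.
Proof.
apply: funext => v; elim: v a b c => [|x v IH] a b c.
  by rewrite !wedge_nil mulrA.
rewrite !wedge_cons !contract_wedge wedgeDr wedgeDl /add_form parity_wedge.
by rewrite !IH addrA.
Qed.

Lemma wedge1l b : wedge (unit_form (V := V)) b = b.
Proof.
apply: funext => v; elim: v b => [|x v IH] b; first by rewrite wedge_nil mul1r.
rewrite wedge_cons; have -> : contract x (unit_form (V:=V)) = fun=> 0 by [].
have -> : parity (unit_form (V:=V)) = unit_form (V:=V).
  apply: funext => s; rewrite /parity /unit_form.
  by case: s => [|y s]; rewrite /= ?mul1r ?mulr0.
by rewrite wedge0l add0r IH.
Qed.

Definition homog (k : nat) a := forall v, size v != k -> a v = 0.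

Lemma homog_contract k x a : homog k a -> homog k.-1 (contract x a).
Proof. by move=> ha v hv; apply: ha; apply: contraNneq hv => <-. Qed.

Lemma homog0_contract x a : homog 0 a -> contract x a = fun=> 0.
Proof. by move=> ha; apply: funext => v; apply: ha. Qed.

Lemma homog_parity k a : homog k a -> parity a = scale_form ((-1) ^+ k) a.
Proof.
move=> ha; apply: funext => v; rewrite /parity /scale_form.
by case: (eqVneq (size v) k) => [-> //|/ha ->]; rewrite !mulr0.
Qed.

Lemma homog_scale k z a : homog k a -> homog k (scale_form z a).
Proof. by move=> ha v /ha; rewrite /scale_form => ->; rewrite mulr0. Qed.

Lemma homog_wedge k l a b : homog k a -> homog l b -> homog (k + l)%N (wedge a b).
Proof.
move=> ha hb v hv; rewrite /wedge big1 // => m _.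
have [hk|/ha ->] := eqVneq (size (mask m v)) k; last by rewrite mulr0 mul0r.
rewrite [b _]hb ?mulr0 //; apply: contraNneq hv => <-; rewrite -hk.
rewrite !size_mask ?size_map ?size_tuple // count_map.
by rewrite -{1}(size_tuple m) -(count_predC id).
Qed.

(** Each half of the Leibniz rule for [wedge b a] matches the opposite half for
    [wedge a b]; when one of the degrees is 0, the half with the contraction of
    that form vanishes. *)
Lemma wedgeC k l a b :
  homog k a -> homog l b -> wedge b a = scale_form ((-1) ^+ (k * l)) (wedge a b).
Proof.
move=> ha hb; apply: funext => v; elim: v k l a b ha hb => [|x v IH] k l a b ha hb.
  rewrite /scale_form !wedge_nil.
  case: k ha => [|k] ha; first by rewrite mul1r mulrC.
  by rewrite ha // mulr0 mul0r mulr0.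
rewrite /scale_form !wedge_cons (homog_parity ha) (homog_parity hb).
rewrite !wedgeZl /scale_form.
rewrite mulrDr addrC; congr (_ + _).
  case: k ha => [|k] ha; first by rewrite homog0_contract // wedge0l wedge0r !mulr0.
  by rewrite (IH _ _ _ _ (homog_contract x ha) hb) /scale_form mulrA -exprD mulSn.
case: l hb => [|l] hb; first by rewrite homog0_contract // wedge0l wedge0r !mulr0.
rewrite (IH _ _ _ _ ha (homog_contract x hb)) /scale_form mulnS exprD.
by rewrite [(-1) ^+ k * _]mulrC -mulrA signrMK.
Qed.

Lemma wedgexx a : homog 1 a -> wedge a a = fun=> 0.
Proof.
move=> ha; apply: funext => v; apply/eqP; rewrite -eqNr.
by rewrite {2}(wedgeC ha ha) /scale_form mulN1r.
Qed.

Lemma homog_form10 J a : form10 J a -> homog 1 a.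
Proof. by case=> -[]. Qed.

Lemma homog_conj k a : homog k a -> homog k (conj_form a).
Proof. by move=> ha v /ha; rewrite /conj_form => ->; rewrite rmorph0. Qed.

Lemma conj_wedge a b :
  conj_form (wedge a b) = wedge (conj_form a) (conj_form b).
Proof.
apply: funext => v; rewrite /conj_form /wedge rmorph_sum; apply: eq_bigr => m _.
by rewrite !rmorphM rmorph_sign.
Qed.

Lemma homog_big1 n (F : 'I_n -> cform V) :
  (forall i, homog 1 (F i)) ->
  homog n (\wedge_(i < n) F i).
Proof.
elim: n F => [|n IH] F hF; first by rewrite big_ord0 => -[].
by rewrite big_ord_recl; apply: (@homog_wedge 1 n) => //; apply: IH.
Qed.

(** Forms of degree 2 commute with everything, so any factor can be moved to the
    front. *)
Lemma big_wedge_lift n (F : 'I_n.+1 -> cform V) (k : 'I_n.+1) :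
  (forall i, homog 2 (F i)) ->
  \wedge_(i < n.+1) F i =
  wedge (F k) (\wedge_(i < n) F (lift k i)).
Proof.
elim: n F k => [|n IH] F k hF.
  by rewrite (ord1 k) big_ord_recl !big_ord0.
rewrite big_ord_recl; case: (unliftP ord0 k) => [j ->|-> //].
rewrite (IH _ j) // [in RHS]big_ord_recl !wedgeA; congr (wedge _ _).
  rewrite [LHS](wedgeC (hF _) (hF _)) -signr_odd scale_form1; congr (wedge _ (F _)).
  by apply: val_inj.
by apply: eq_bigr => i _; congr F; apply: val_inj; rewrite /= /bump !add1n ltnS addnS.
Qed.

Lemma wedge_big_eq0 n (F : 'I_n -> cform V) (k : 'I_n) a :
  (forall i, homog 2 (F i)) -> wedge a (F k) = (fun=> 0) ->
  wedge a (\wedge_(i < n) F i) = fun=> 0.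
Proof.
case: n F k => [F []//|n] F k hF ak.
by rewrite (big_wedge_lift k) // wedgeA ak wedge0l.
Qed.

Lemma contract_wedge1 x a b : homog 1 a ->
  contract x (wedge a b) =
  add_form (scale_form (a [:: x]) b) (scale_form (-1) (wedge a (contract x b))).
Proof.
move=> ha; rewrite contract_wedge (homog_parity ha) wedgeZl; congr add_form.
suff -> : contract x a = scale_form (a [:: x]) (unit_form (V:=V)).
  by rewrite wedgeZl wedge1l.
apply: funext => -[|y v]; rewrite /scale_form /unit_form /= ?mulr1 ?mulr0 //.
exact: ha.
Qed.

(** The real semi-positive (1,1)-form of a (1,0)-form [a]; volume forms are
    positive multiples of products of these. *)
Definition herm a : cform V := scale_form 'i%C (wedge a (conj_form a)).

Lemma homog_herm a : homog 1 a -> homog 2 (herm a).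
Proof. by move=> ha; apply/homog_scale/(@homog_wedge 1 1)/homog_conj. Qed.

Lemma wedge_herm a : homog 1 a -> wedge a (herm a) = fun=> 0.
Proof.
by move=> ha; rewrite /herm wedgeZr wedgeA wedgexx // wedge0l scale_form_eq0.
Qed.

Lemma wedge_conj_herm a : homog 1 a -> wedge (conj_form a) (herm a) = fun=> 0.
Proof.
move=> ha; have hc := homog_conj ha.
rewrite /herm wedgeZr wedgeA (wedgeC ha hc) wedgeZl -wedgeA wedgexx //.
by rewrite wedge0r !scale_form_eq0.
Qed.

Lemma wedge_lincomb n (a : 'I_n.+1 -> cform V) (c : 'I_n.+1 -> R[i]) (k : 'I_n.+1) b w :
  (forall v, b v = \sum_j c j * a j v) ->
  (forall j, wedge (a (lift k j)) w = fun=> 0) ->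
  wedge b w = scale_form (c k) (wedge (a k) w).
Proof.
move=> bE aw; rewrite (funext bE); apply: funext => v.
rewrite (wedge_suml (fun j => scale_form (c j) (a j))) (bigD1_ord k) //= big1 ?addr0.
  by rewrite wedgeZl.
by move=> j _; rewrite wedgeZl aw scale_form_eq0.
Qed.

(** The exchange step that keeps track of positivity: replacing the factor of
    [a k] by that of a form [b] with coefficient [c k] on [a k] multiplies the
    product by the non-negative number |c k|^2. *)
Lemma herm_exchange n (a : 'I_n.+1 -> cform V) (c : 'I_n.+1 -> R[i]) (k : 'I_n.+1) b :
  (forall j, homog 1 (a j)) -> homog 1 b ->
  (forall v, b v = \sum_j c j * a j v) ->
  let P := \wedge_(j < n) herm (a (lift k j)) in
  wedge (herm b) P = scale_form (c k * (c k)^*)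
    (\wedge_(j < n.+1) herm (a j)).
Proof.
move=> ha hb bE P; have h2 j : homog 2 (herm (a j)) by apply: homog_herm.
have bcE v : conj_form b v = \sum_j (c j)^* * conj_form (a j) v.
  by rewrite /conj_form bE rmorph_sum; apply: eq_bigr => j _; rewrite rmorphM.
have bP : wedge b P = scale_form (c k) (wedge (a k) P).
  apply: wedge_lincomb bE _ => j; apply: (wedge_big_eq0 (k := j)) => //.
  exact: wedge_herm.
have bcP : wedge (conj_form b) P = scale_form (c k)^* (wedge (conj_form (a k)) P).
  apply: (wedge_lincomb (a := fun j => conj_form (a j))) bcE _ => j.
  apply: (wedge_big_eq0 (k := j)) => //; exact: wedge_conj_herm.
have hck := homog_conj (ha k).
rewrite (big_wedge_lift k) // /herm !wedgeZl -!wedgeA bcP wedgeZr.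
rewrite wedgeA (wedgeC hck hb) wedgeZl -wedgeA bP wedgeZr wedgeA (wedgeC (ha k) hck).
rewrite wedgeZl wedgeA !scale_formA; congr scale_form.
by rewrite expr1; ring.
Qed.
End FormAlgebra.

(** * Pullback *)

Section Pullback.
Variables (R : realType) (U V : vectType R) (f : U -> V).
Implicit Types a b : cform V.

Definition pull a : cform U := fun s => a (map f s).

Lemma pull_wedge a b : pull (wedge a b) = wedge (pull a) (pull b).
Proof.
apply: funext => v; elim: v a b => [|x v IH] a b; first by rewrite /pull /= !wedge_nil.
rewrite /pull /= !wedge_cons; congr (_ + _); first exact: IH.
rewrite -/(pull _ _) IH; congr (wedge _ _ _).
by apply: funext => s; rewrite /pull /parity size_map.
Qed.

Lemma pull_unit : pull (unit_form (V := V)) = unit_form (V := U).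
Proof. by apply: funext => v; rewrite /pull /unit_form size_map. Qed.

Lemma pull_big n (F : 'I_n -> cform V) :
  pull (\wedge_(i < n) F i) =
  \wedge_(i < n) pull (F i).
Proof. exact: (big_morph pull pull_wedge pull_unit). Qed.

Lemma pull_herm a : pull (herm a) = herm (pull a).
Proof. by rewrite {1}/herm -[LHS]/(scale_form _ (pull (wedge _ _))) pull_wedge. Qed.

Lemma pull_kform k a : (forall (z : R) x y, f (z *: x + y) = z *: f x + f y) ->
  kform k a -> kform k (pull a).
Proof.
move=> lf [hs hl ha]; split.
- by move=> v hv; apply: hs; rewrite size_map.
- by move=> s t z x y; rewrite /pull !map_cat /= lf hl.
- by move=> s t u x; rewrite /pull !(map_cat, map_cons) ha.
Qed.

Lemma pull_form10 (JU : 'End(U)) (JV : 'End(V)) a :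
  (forall (z : R) x y, f (z *: x + y) = z *: f x + f y) ->
  (forall x, f (JU x) = JV (f x)) -> form10 JV a -> form10 JU (pull a).
Proof.
move=> lf fJ [ka Ja]; split; first exact: pull_kform.
by move=> x; rewrite /pull /= fJ Ja.
Qed.

Lemma pull_pqform (JU : 'End(U)) (JV : 'End(V)) p q a :
  (forall (z : R) x y, f (z *: x + y) = z *: f x + f y) ->
  (forall x, f (JU x) = JV (f x)) -> pqform JV p q a -> pqform JU p q (pull a).
Proof.
move=> lf fJ [N [c [A [B [hA hB aE]]]]].
exists N, c, (fun t j => pull (A t j)), (fun t j => pull (B t j)); split.
- by move=> t j; apply: pull_form10 (hA t j).
- by move=> t j; apply: pull_form10 (hB t j).
- move=> v; rewrite /pull aE; apply: eq_bigr => t _.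
  by rewrite -/(pull _ _) pull_wedge !pull_big.
Qed.

Lemma pull_closed (brU : U -> U -> U) (brV : V -> V -> V) a :
  (forall x y, f (brU x y) = brV (f x) (f y)) ->
  closed_form brV a -> closed_form brU (pull a).
Proof.
move=> fbr ca v; rewrite -(ca (map f v)) /chevalley_eilenberg_d size_map.
apply: eq_bigr => i _; apply: eq_bigr => j _; congr (_ * _).
rewrite /pull /= fbr !(nth_map 0) //.
by rewrite /omit !map_cat !map_take !map_drop !map_cat !map_take !map_drop.
Qed.
End Pullback.

(** * Splitting along the kernel of a (1,0)-form *)

Lemma form10_complex_linear (R : realType) (V : vectType R) (J : 'End(V))
    a x y (z : R[i]) :
  form10 J a ->
  a [:: complex.Re z *: x + complex.Im z *: J x + y] = z * a [:: x] + a [:: y].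
Proof.
move=> [[_ la _] Ja]; rewrite -addrA (la [::] [::]) (la [::] [::]) /= Ja.
rewrite addrA mulrA -mulrDl.
by congr (_ * _ + _); case: z => u v /=; simpc.
Qed.

Lemma linear_end (R : realType) (V : vectType R) (f : V -> V) :
  (forall (z : R) x y, f (z *: x + y) = z *: f x + f y) ->
  exists r : 'End(V), forall x, r x = f x.
Proof.
move=> lf; pose L := GRing.isLinear.Build _ _ _ _ f lf.
pose F : {linear V -> V} := HB.pack f L.
by exists (linfun F) => x; rewrite lfunE.
Qed.

(** The endomorphism [r] is the complex linear projector alpha(.) e onto the
    complex line of [e]; its kernel is that of [a] and its image is spanned by
    [e] and [J e], which gives the codimension. *)
Lemma form10_split (R : realType) (V : vectType R) (J : 'End(V)) (a : cform V) :
  (forall x, J (J x) = - x) -> form10 J a -> nonzero_form a ->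
  exists (e : V) (r : 'End(V)),
    [/\ a [:: e] = 1,
        forall x, r x = complex.Re (a [:: x]) *: e + complex.Im (a [:: x]) *: J e,
        forall x, (x \in lker r) = (a [:: x] == 0),
        forall x, r (J x) = J (r x)
      & (\dim (lker r) + 2)%N = \dim {:V}].
Proof.
move=> JJ fa [v av]; have [[ha la _] Ja] := fa.
have a0 : a [:: 0] = 0.
  have := la [::] [::] 1 0 0; rewrite scaler0 addr0 mul1r /= => a00.
  by apply: (addrI (a [:: 0])); rewrite addr0 -a00.
have [x ax] : exists x, a [:: x] != 0.
  have : size v == 1%N by apply: contraNT av => /ha ->.
  by case: v av => [|x []] //; exists x.
(* Divide x by the complex number a(x). *)
have [e ae] : exists e, a [:: e] = 1.
  pose z := (a [:: x])^-1.
  exists (complex.Re z *: x + complex.Im z *: J x + 0).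
  by rewrite (form10_complex_linear _ _ _ fa) a0 addr0 mulVf.
pose f y := complex.Re (a [:: y]) *: e + complex.Im (a [:: y]) *: J e.
have lf (u : R) y w : f (u *: y + w) = u *: f y + f w.
  rewrite /f (la [::] [::]) /=; case: (a [:: y]) (a [:: w]) => [y1 y2] [w1 w2].
  rewrite scalerDr !scalerA addrACA -!scalerDl /=.
  by congr (_ *: _ + _ *: _); rewrite !mul0r ?subr0 ?addr0.
have [r rE] := linear_end lf.
have ar y : a [:: r y] = a [:: y].
  by rewrite rE -[f y]addr0 (form10_complex_linear _ _ _ fa) ae a0 addr0 mulr1.
exists e, r; split => //.
- move=> y; rewrite memv_ker; apply/eqP/eqP => [ry|ay].
    by rewrite -ar ry.
  by rewrite rE /f ay /= !scale0r addr0.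
- move=> y; rewrite !rE /f Ja; case: (a [:: y]) => y1 y2 /=.
  rewrite linearD !linearZ /= JJ !mul0r !mul1r sub0r add0r addrC scalerN scaleNr.
  by [].
rewrite -(limg_ker_dim r fullv) capfv; congr (_ + _)%N.
have re : r e = e by rewrite rE /f ae /= scale1r scale0r addr0.
have rJe : r (J e) = J e.
  by rewrite rE /f Ja ae mulr1 /= scale1r scale0r add0r.
have -> : (r @: fullv)%VS = <<[:: e; J e]>>%VS.
  apply/eqP; rewrite eqEsubv; apply/andP; split; apply/subvP => y.
    case/memv_imgP => w _ ->; rewrite rE.
    by rewrite memvD // memvZ // memv_span // !inE eqxx ?orbT.
  apply: subvP y; apply/span_subvP => y; rewrite !inE => /orP[]/eqP->.
    by rewrite -{1}re memv_img ?memvf.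
  by rewrite -{1}rJe memv_img ?memvf.
suff : free [:: e; J e] by rewrite /free => /eqP->.
have Je0 : J e != 0.
  apply/eqP => Je; have := Ja e; rewrite Je a0 ae mulr1 => /eqP.
  by rewrite eq_complex /= [0 == 1]eq_sym oner_eq0 andbF.
rewrite free_cons seq1_free Je0 andbT span_seq1; apply/vlineP => -[k ek].
have := la [::] [::] k (J e) 0; rewrite /= addr0 -ek a0 addr0 Ja ae mulr1 => /eqP.
by rewrite eq_complex /= mulr0 mul0r subr0 oner_eq0.
Qed.

(** * Coframes and volume forms *)

(** [basis10] for an arbitrary index set ['I_m], so that the dimension can be
    rewritten without casting indices. *)
Definition coframe (R : realType) (V : vectType R) (J : 'End(V)) m
    (a : 'I_m -> cform V) : Prop :=
  [/\ forall j, form10 J (a j),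
      forall c : 'I_m -> R[i],
        (forall v, \sum_j c j * a j v = 0) -> forall j, c j = 0
    & forall b, form10 J b ->
        exists c : 'I_m -> R[i], forall v, b v = \sum_j c j * a j v].

Lemma volume_formE (R : realType) (V : vectType R) (J : 'End(V)) m w :
  cdim V = m ->
  volume_form J w <-> exists (c : R) (a : 'I_m -> cform V),
    [/\ 0 < c, coframe J a
      & w =1 scale_form c%:C (\wedge_(j < m) herm (a j))].
Proof. by move=> <-. Qed.

Lemma form10_lincomb (R : realType) (V : vectType R) (J : 'End(V)) m
    (a : 'I_m -> cform V) (c : 'I_m -> R[i]) :
  (forall j, form10 J (a j)) -> form10 J (fun v => \sum_j c j * a j v).
Proof.
move=> fa; split; first split.
- by move=> v hv; rewrite big1 // => j _; have [[-> //]] := fa j; rewrite mulr0.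
- move=> s t z x y; rewrite mulr_sumr -big_split; apply: eq_bigr => j _ /=.
  by have [[_ -> _] _] := fa j; rewrite mulrDr mulrCA.
- by move=> s t u x; rewrite big1 // => j _; have [[_ _ ->] _] := fa j; rewrite mulr0.
move=> x; rewrite mulr_sumr; apply: eq_bigr => j _.
by have [_ ->] := fa j; rewrite mulrCA.
Qed.

(** * Restriction to the kernel of a (1,0)-form *)

Section Hyperplane.
Variables (R : realType) (V : vectType R) (J : 'End(V)) (alpha : cform V).
Variables (e : V) (r : 'End(V)).
Hypotheses (fal : form10 J alpha) (ale : alpha [:: e] = 1).
Hypothesis (rE : forall x, r x =
  complex.Re (alpha [:: x]) *: e + complex.Im (alpha [:: x]) *: J e).
Hypothesis (hE : forall x, (x \in lker r) = (alpha [:: x] == 0)).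
Hypothesis (rJ : forall x, r (J x) = J (r x)).

Local Notation h := (lker r).
Local Notation Jh := (restr_end J h).
Local Notation res := (pull (fun x : subvs_of h => vsval x)).

Lemma ker_stable : (J @: h <= h)%VS.
Proof.
apply/subvP => _ /memv_imgP[x xh ->]; move: xh; rewrite !hE => /eqP ax.
by have [_ ->] := fal; rewrite ax mulr0.
Qed.

Lemma sub_proj_ker x : x - r x \in h.
Proof.
have := form10_complex_linear e 0 (alpha [:: x]) fal.
rewrite -rE addr0 => arx; rewrite memv_ker linearB /= subr_eq0.
apply/eqP; rewrite [in RHS](rE (r x)).
suff -> : alpha [:: r x] = alpha [:: x] by rewrite -rE.
have a0 : alpha [:: 0] = 0.
  by apply/eqP; rewrite -hE mem0v.
by rewrite arx ale a0 addr0 mulr1.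
Qed.

(** Pulling back along this complex linear retraction extends forms from the
    kernel to the whole space. *)
Definition ker_proj x : subvs_of h := vsproj h (x - r x).

Lemma ker_projE x : vsval (ker_proj x) = x - r x.
Proof. by rewrite vsprojK // sub_proj_ker. Qed.

Lemma ker_proj_linear (z : R) x y :
  ker_proj (z *: x + y) = z *: ker_proj x + ker_proj y.
Proof.
by apply: val_inj; rewrite /= !ker_projE linearP /= opprD addrACA scalerBr.
Qed.

Lemma ker_proj_J x : ker_proj (J x) = Jh (ker_proj x).
Proof.
by apply: val_inj; rewrite /= restr_endE ?ker_stable // !ker_projE linearB /= rJ.
Qed.

Lemma ker_projK (x : subvs_of h) : ker_proj (vsval x) = x.
Proof.
apply: val_inj; rewrite /= ker_projE; have := subvsP x; rewrite memv_ker => /eqP->.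
by rewrite subr0.
Qed.

Lemma res_form10 a : form10 J a -> form10 Jh (res a).
Proof.
apply: pull_form10 => [z x y|x]; first by rewrite linearP.
by rewrite restr_endE ?ker_stable.
Qed.

Lemma ext_form10 (a : cform (subvs_of h)) : form10 Jh a -> form10 J (pull ker_proj a).
Proof. exact: pull_form10 ker_proj_linear ker_proj_J. Qed.

Lemma res_ext (a : cform (subvs_of h)) : res (pull ker_proj a) = a.
Proof.
by apply: funext => v; rewrite /pull -map_comp (eq_map ker_projK) map_id.
Qed.

Lemma res_alpha : res alpha = fun=> 0.
Proof.
have [[ha _ _] _] := fal; apply: funext => v.
have [|] := eqVneq (size v) 1%N; last by move=> hv; apply: ha; rewrite size_map.
by case: v => [|x []] // _; apply/eqP; rewrite -hE subvsP.
Qed.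

Lemma form10_vanish b : form10 J b -> res b = (fun=> 0) ->
  forall v, b v = b [:: e] * alpha v.
Proof.
move=> fb b0 v; have [[hb _ _] _] := fb.
have [|hv] := eqVneq (size v) 1%N; last first.
  by rewrite hb //; have [[-> //]] := fal; rewrite mulr0.
case: v => [|x []] // _.
have bk : b [:: x - r x] = 0.
  by rewrite -ker_projE -[LHS]/(res b [:: ker_proj x]) b0.
rewrite -[in LHS](addrNK (r x) x) addrC rE.
by rewrite (form10_complex_linear _ _ _ fb) -rE bk addr0 mulrC.
Qed.

(** A combination of the [a j], [j != k], that vanishes on the kernel is a multiple
    of [alpha], and the multiple is 0 because [alpha] has a component along [a k].
    The restrictions generate since [alpha] restricts to 0, which expresses the
    restriction of [a k] by the other ones. *)
Lemma coframe_res m (a : 'I_m.+1 -> cform V) (c : 'I_m.+1 -> R[i]) (k : 'I_m.+1) :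
  coframe J a -> (forall v, alpha v = \sum_j c j * a j v) -> c k != 0 ->
  coframe Jh (fun j : 'I_m => res (a (lift k j))).
Proof.
move=> [fa ia sa] alE ck; split.
- by move=> j; apply: res_form10.
- move=> d d0; pose b v := \sum_j d j * a (lift k j) v.
  have fb : form10 J b by apply: form10_lincomb.
  have bE := form10_vanish fb (funext d0).
  (* d extended by 0 at the index k *)
  pose D i := oapp d 0 (unlift k i).
  have DE i : D i = b [:: e] * c i.
    apply/eqP; rewrite -subr_eq0; apply/eqP; move: i; apply: ia => v.
    under eq_bigr => j _ do rewrite mulrBl -mulrA.
    rewrite sumrB -mulr_sumr -alE -bE (bigD1_ord k) //= /D unlift_none /= mul0r add0r.
    by under eq_bigr => j _ do rewrite liftK /=; rewrite subrr.
  have be : b [:: e] = 0.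
    have /esym/eqP := DE k; rewrite /D unlift_none /= mulf_eq0 (negPf ck) orbF.
    by move/eqP.
  by move=> j; have := DE (lift k j); rewrite /D liftK /= be mul0r.
move=> b fb; have [d dE] := sa _ (ext_form10 fb).
exists (fun j => d (lift k j) - d k / c k * c (lift k j)) => v.
rewrite -[in LHS](res_ext b) {1}/pull dE (bigD1_ord k) //=.
have : alpha (map vsval v) = 0 by rewrite -[LHS]/(res alpha v) res_alpha.
rewrite alE (bigD1_ord k) //= => /eqP; rewrite addr_eq0 => /eqP ak.
under [RHS]eq_bigr => j _ do rewrite mulrBl -[X in _ - X]mulrA.
rewrite sumrB -mulr_sumr addrC; congr (_ + _).
rewrite -mulrN; transitivity (d k / c k * (c k * a k (map vsval v))).
  by rewrite mulrA divfK.
by rewrite ak.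
Qed.

(** A factor [alpha] or its conjugate that has not been contracted dies on the
    kernel.  What survives is i (alpha ^ conj alpha)(e, J e) = i (- i - i) = 2. *)
Lemma herm_contract Y :
  res (contract (J e) (contract e (wedge (herm alpha) Y))) = scale_form 2 (res Y).
Proof.
have hal := homog_form10 fal; have hc := homog_conj hal.
have [_ Ja] := fal.
have res1 Z : res (wedge alpha Z) = fun=> 0 by rewrite pull_wedge res_alpha wedge0l.
have resc1 Z : res (wedge (conj_form alpha) Z) = fun=> 0.
  rewrite pull_wedge -[pull _ (conj_form _)]/(conj_form (res alpha)) res_alpha.
  suff -> : conj_form (fun=> 0) = (fun=> 0) :> cform (subvs_of h) by rewrite wedge0l.
  by apply: funext => s; rewrite /conj_form rmorph0.
apply: funext => v.
have r1 Z : wedge alpha Z (map vsval v) = 0 by rewrite -[LHS]/(res _ v) res1.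
have rc1 Z : wedge (conj_form alpha) Z (map vsval v) = 0.
  by rewrite -[LHS]/(res _ v) resc1.
rewrite /herm wedgeZl -wedgeA /pull /contract /scale_form.
rewrite -[wedge alpha _ _]/(contract (J e) (contract e (wedge alpha _)) _).
rewrite (contract_wedge1 _ _ hal).
rewrite -[contract _ _ _]/(add_form (scale_form (alpha [:: e])
  (contract (J e) (wedge (conj_form alpha) Y)))
  (scale_form (-1) (contract (J e)
    (wedge alpha (contract e (wedge (conj_form alpha) Y))))) _).
rewrite !contract_wedge1 // /add_form /scale_form r1 !rc1 /conj_form Ja ale.
have ii : 'i%C * 'i%C = -1 :> R[i] by rewrite -expr2 sqr_i.
have ci : ('i%C : R[i])^* = - 'i%C by apply/eqP; rewrite eq_complex /= oppr0 !eqxx.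
rewrite mulr1 ci rmorph1.
transitivity (- ('i%C * 'i%C) * (2 * Y (map vsval v))); first by ring.
by rewrite ii opprK mul1r.
Qed.

(** The signs come from moving [alpha] in front of a form of degree 2p and its
    conjugate in front of a form of degree 2p + q. *)
Lemma transverse_sign p q :
  'i%C ^+ (q.+1 ^ 2) * (-1) ^+ (1 * (p + p)) * (-1) ^+ (1 * (p + p + q)) =
  'i%C * 'i%C ^+ (q ^ 2) :> R[i].
Proof.
have -> : (q.+1 ^ 2 = 2 * q + q ^ 2 + 1)%N by ring.
rewrite !mul1n addnn -muln2 [(p * 2)%N]mulnC 2!exprD expr1 [(-1) ^+ (_ + q)]exprD.
rewrite !exprM sqr_i sqrrN expr1n expr1n mulr1 mul1r.
by rewrite -!mulrA mulrC [RHS]mulrC -!mulrA -expr2 sqrr_sign mulr1.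
Qed.

(** Testing [w] on alpha ^ M, with M an extension of psi, exhibits the restriction
    of i^(q^2) w ^ M ^ conj M as a positive multiple of the product of the
    restricted coframe. *)
Lemma transverse_res p m w :
  cdim V = m.+1 -> cdim (subvs_of h) = m -> (p <= m)%N ->
  homog (p + p)%N w -> transverse J p w -> transverse Jh p (res w).
Proof.
move=> cV ch pm hw tw psi [mu fmu psiE] [v0 psi0]; rewrite ch in mu fmu psiE *.
set q := (m - p)%N in mu fmu psiE *.
have hal := homog_form10 fal.
pose M := \wedge_(j < q) pull ker_proj (mu j).
have resM : res M = psi.
  by apply: funext => v; rewrite pull_big psiE; under eq_bigr do rewrite res_ext.
have hM : homog q M.
  apply: homog_big1 => j; exact: homog_form10 (ext_form10 (fmu j)).
have res_wedge_al Z : res (wedge alpha Z) = fun=> 0.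
  by rewrite pull_wedge res_alpha wedge0l.
have ns : nonzero_form (wedge alpha M).
  exists (e :: map vsval v0).
  rewrite -[wedge _ _ _]/(contract e (wedge alpha M) _) contract_wedge1 //.
  rewrite /add_form /scale_form ale mul1r.
  rewrite -[wedge _ _ _]/(res (wedge alpha (contract e M)) v0) res_wedge_al mulr0 addr0.
  by rewrite -[M _]/(res M v0) resM.
have ss : simple_form J (cdim V - p) (wedge alpha M).
  rewrite cV subSn //.
  exists (fun j => oapp (fun j' => pull ker_proj (mu j')) alpha (unlift ord0 j)).
    by move=> j; case: (unlift ord0 j) => [j'|] //=; apply: ext_form10.
  move=> v; rewrite big_ord_recl unlift_none /=.
  by under eq_bigr do rewrite liftK.
have := tw _ ss ns; rewrite (volume_formE _ _ cV) cV subSn // -/q.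
case=> c [a [c0 fa wE]].
have [d dE] := (let: And3 _ _ s := fa in s) _ fal.
have [k dk] : exists k, d k != 0.
  apply/existsP; apply: contraT; rewrite negb_exists => /forallP d0.
  have := ale; rewrite dE big1 => [/esym/eqP|j _]; first by rewrite oner_eq0.
  by have /negPn/eqP-> := d0 j; rewrite mul0r.
pose N := complex.Re (d k) ^+ 2 + complex.Im (d k) ^+ 2.
have NE : d k * (d k)^* = N%:C.
  rewrite /N; case: (d k) => x y; apply/eqP; rewrite eq_complex /=.
  by apply/andP; split; apply/eqP; ring.
have N0 : 0 < N.
  move: dk; rewrite /N; case: (d k) => x y; rewrite eq_complex /= => xy.
  rewrite lt_neqAle addr_ge0 ?sqr_ge0 // andbT eq_sym.
  by rewrite paddr_eq0 ?sqr_ge0 // !sqrf_eq0.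
have hfa j : homog 1 (a j) by have [f _ _] := fa; apply: homog_form10 (f j).
pose P := \wedge_(j < m) herm (a (lift k j)).
have aP := herm_exchange k hfa hal dE; rewrite -/P NE in aP.
pose W := scale_form ('i%C ^+ (q ^ 2)) (wedge (wedge w M) (conj_form M)).
have aW : wedge (herm alpha) W = scale_form ('i%C ^+ (q.+1 ^ 2))
    (wedge (wedge w (wedge alpha M)) (conj_form (wedge alpha M))).
  have hwM := homog_wedge hw hM.
  rewrite conj_wedge [wedge w (wedge alpha M)]wedgeA [wedge w alpha](wedgeC hal hw).
  rewrite !wedgeZl.
  rewrite -[wedge (wedge alpha w) M]wedgeA [wedge _ (wedge (conj_form alpha) _)]wedgeA.
  rewrite -[wedge (wedge alpha _) (conj_form alpha)]wedgeA.
  rewrite (wedgeC (homog_conj hal) hwM) wedgeZr wedgeZl !scale_formA transverse_sign.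
  by rewrite /W wedgeZr scale_formA !wedgeA.
have aWP : scale_form N%:C (wedge (herm alpha) W) =
    scale_form c%:C (wedge (herm alpha) P).
  by rewrite aW (funext wE) aP !scale_formA mulrC.
have resWP : scale_form N%:C (res W) = scale_form c%:C (res P).
  apply: funext => v; apply: (mulfI (x := 2)); first by rewrite pnatr_eq0.
  rewrite /scale_form mulrCA [RHS]mulrCA.
  rewrite -[2 * _]/(scale_form 2 (res W) v) -[2 * _ in RHS]/(scale_form 2 (res P) v).
  rewrite -!herm_contract.
  exact: (congr1 (fun a' => a' (e :: J e :: map vsval v)) aWP).
rewrite (volume_formE _ _ ch).
exists (c / N), (fun j => res (a (lift k j))); split.
- exact: divr_gt0.
- exact: coframe_res fa dE dk.
have -> : scale_form ('i%C ^+ (q ^ 2))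
    (wedge (wedge (res w) psi) (conj_form psi)) = res W.
  by rewrite -resM -[conj_form (res M)]/(res (conj_form M)) -!pull_wedge.
have -> : \wedge_(j < m) herm (res (a (lift k j))) = res P.
  by rewrite pull_big; apply: eq_bigr => j _; rewrite pull_herm.
have N0' : N%:C != 0 by rewrite fmorph_eq0 gt_eqF.
move=> v; apply: (mulfI N0'); have := congr1 (fun a' => a' v) resWP.
by rewrite /scale_form => ->; rewrite mulrA -rmorphM mulrCA divff ?mulr1 // gt_eqF.
Qed.
End Hyperplane.

(** * The ideal and its p-Kaehler structure *)

Lemma closed_form10_bracket (R : realType) (V : vectType R) (br : V -> V -> V)
    (a : cform V) x y : closed_form br a -> a [:: br x y] = 0.
Proof.
move/(_ [:: x; y]); rewrite /chevalley_eilenberg_d /= big_ord_recl big_mkcond.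
rewrite !big_ord_recl !big_ord0 /= big_mkcond !big_ord_recl !big_ord0 /=.
rewrite !(addr0, add0r) expr1 mulN1r => /eqP; rewrite oppr_eq0 => /eqP <-.
by [].
Qed.

Lemma homog_pqform (R : realType) (V : vectType R) (J : 'End(V)) p q (w : cform V) :
  pqform J p q w -> homog (p + q)%N w.
Proof.
move=> [N [c [a [b [fa fb wE]]]]] v hv; rewrite wE big1 // => t _.
rewrite (homog_wedge (k := p) (l := q)) ?mulr0 //.
  by apply: homog_big1 => j; apply: homog_form10 (fa t j).
by apply: homog_big1 => j; apply/homog_conj/homog_form10/(fb t j).
Qed.

Theorem proposition2p5 (R : realType) (g : vectType R) (br : g -> g -> g)
    (J : 'End(g)) (n p : nat) (Omega alpha : cform g) :
  lie_bracket br ->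
  complex_structure br J ->
  \dim {:g} = (2 * n)%N ->
  (3 <= n)%N ->
  (1 <= p < n - 1)%N ->
  pkahler br J p Omega ->
  form10 J alpha ->
  nonzero_form alpha ->
  closed_form br alpha ->
  exists h : {vspace g},
    [/\ lie_ideal br h,
        (J @: h <= h)%VS,
        (\dim h + 2)%N = \dim {:g}
      & exists Omega' : cform (subvs_of h),
          pkahler (restr_br br h) (restr_end J h) p Omega'].
Proof.
move=> _ [JJ _] dimg n3 /andP[p1 pn] [_ [Opq Oreal Otr Ocl]] fal al0 alcl.
have [e [r [ale rE hE rJ dimh]]] := form10_split JJ fal al0.
have hideal : lie_ideal br (lker r).
  by move=> x y _; rewrite hE (closed_form10_bracket _ _ alcl).
have hJ : (J @: lker r <= lker r)%VS by apply: ker_stable fal hE.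
have cg : cdim g = (n - 1).+1 by rewrite /cdim dimg mul2n doubleK; lia.
have ch : cdim (subvs_of (lker r)) = (n - 1)%N.
  rewrite /cdim dimvf /dim /=; move: dimh; rewrite dimg; lia.
exists (lker r); split => //.
exists (pull (fun x : subvs_of (lker r) => vsval x) Omega).
split; first by rewrite ch p1.
split.
- apply: pull_pqform Opq => [z x y|x]; first by rewrite linearP.
  by rewrite restr_endE.
- by move=> v; apply: Oreal.
- apply: (transverse_res fal ale rE hE rJ cg ch) Otr; first exact: ltnW.
  exact: homog_pqform Opq.
- by apply: pull_closed Ocl => x y; rewrite restr_brE.
Qed.
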